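(* Fix $t\in[0,T]$. Let $(Z_{n,ij})_{(i,j)\in L_n}$ be an array of random variables, and let $\Delta_n>0$, $\mathcal{K}_n\in\mathbb{N}$. Suppose that for all $n\in\mathbb{N}$ there exist a $\Delta_n$-partition $(G^t(k,m,\Delta_n))_{k,m}$ of the network at time $t$ with $\mathcal{K}_n$ block types such that $$\sum_{(i,j)\in L_n}Z_{n,ij}=\sum_{k=1}^{\mathcal{K}_n}\sum_{m=1}^{\infty}\sum_{(i,j)\in L_n}Z_{n,ij}I_{n,ij}^{k,m,t}(\Delta_n),$$ and numbers $E_{k,m}^{n,t},E_k^{n,t}>0$ for $k=1,\dots,\mathcal{K}_n$ and $m=1,\dots,r_n$, as well as $\sigma^2,c_1,c_2,c_3>0$ (not depending on $n$) such that: (1) for all $n\in\mathbb{N}$, $\rho\in\mathbb{N}\setminus\{0,1\}$, $k\in\{1,\dots,\mathcal{K}_n\}$, $m\in\{1,\dots,r_n\}$, $$\mathbb{E}\big(|U_{k,m}^{n,t}(\Delta_n)|^{\rho}\big)\leq\frac{\rho!}{2}E_{k,m}^{n,t}\sigma^2\big(E_k^{n,t}c_1\big)^{\rho-2};$$ (2) for $|E|_{n,t}:=\sum_{k=1}^{\mathcal{K}_n}\sum_{m=1}^{r_n}E_{k,m}^{n,t}$ it holds for all $n\in\mathbb{N}$ and all $k=1,\dots,\mathcal{K}_n$ that $$\frac{1}{|E|_{n,t}}\sum_{m=1}^{r_n}E_{k,m}^{n,t}\geq c_2\quad\text{and}\quad E_k^{n,t}\leq c_3\sqrt{\frac{|E|_{n,t}}{\log|E|_{n,t}}}.$$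 Then, for any $x>0$ and all $n\in\mathbb{N}$, $$\mathbb{P}\Bigg(\frac{1}{|E|_{n,t}}\sum_{(i,j)\in L_n}\big(Z_{n,ij}-\mathbb{E}(Z_{n,ij})\big)\geq x\sqrt{\frac{\log|E|_{n,t}}{|E|_{n,t}}}\Bigg)\leq\mathcal{K}_n\,|E|_{n,t}^{-\frac{c_2x^2}{2(\sigma^2+c_1c_3x)}}+\beta_t(\Delta_n)\,\mathcal{K}_nr_n.$$
   Context: For $n\in\mathbb{N}$, $V_n=\{1,\dots,n\}$, $L_n$ is the set of directed (alternatively undirected) pairs $(i,j)$, $i\neq j$, of elements of $V_n$, and $r_n=|L_n|$. For $t\in[0,T]$, $d_t^n:L_n\times L_n\to[0,\infty]$ is a random function that is almost surely a metric. **$\Delta$-partition.** For $\Delta>0$ and $\mathcal{K}\in\mathbb{N}$, random sets $G^t(k,m,\Delta)\subseteq L_n$ ($k\in\{1,\dots,\mathcal{K}\}$, $m\in\mathbb{N}$) form a $\Delta$-partition of the network at time $t$ with $\mathcal{K}$ block types if (a) $(k,m)\neq(k',m')$ implies $G^t(k,m,\Delta)\cap G^t(k',m',\Delta)=\emptyset$; and (b) for each $k$ and $m\neq m'$, $u\in G^t(k,m,\Delta)$ and $v\in G^t(k,m',\Delta)$ imply $d_t^n(u,v)\geq\Delta$. The sets need not cover $L_n$. Blocks are numbered so that $G^t(k,m,\Delta)=\emptyset$ for $m>r_n$. **Grouping.** $I_{n,ij}^{k,m,t}(\Delta)=\mathbf{1}((i,j)\in G^t(k,m,\Delta))$ and $$U_{k,m}^{n,t}(\Delta)=\sum_{(i,j)\in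 L_n}\Big[Z_{n,ij}I_{n,ij}^{k,m,t}(\Delta)-\mathbb{E}\big(Z_{n,ij}I_{n,ij}^{k,m,t}(\Delta)\big)\Big].$$ **Mixing coefficient.** For $\sigma$-fields $\mathcal{A},\mathcal{B}$, $\beta(\mathcal{A},\mathcal{B})=\sup_{C\in\mathcal{A}\otimes\mathcal{B}}|\mathbb{P}_{\mathcal{A}\otimes\mathcal{B}}(C)-(\mathbb{P}_{\mathcal{A}}\otimes\mathbb{P}_{\mathcal{B}})(C)|$, where $\mathbb{P}_{\mathcal{A}\otimes\mathcal{B}}$ and $\mathbb{P}_{\mathcal{A}}\otimes\mathbb{P}_{\mathcal{B}}$ are the measures on $\mathcal{A}\otimes\mathcal{B}$ with $\mathbb{P}_{\mathcal{A}\otimes\mathcal{B}}(A\times B)=\mathbb{P}(A\cap B)$ and $(\mathbb{P}_{\mathcal{A}}\otimes\mathbb{P}_{\mathcal{B}})(A\times B)=\mathbb{P}(A)\mathbb{P}(B)$; for random variables $\beta(X,Y)=\beta(\sigma(X),\sigma(Y))$. Then $$\beta_t(\Delta)=\max_{k\in\{1,\dots,\mathcal{K}\},\,M\in\mathbb{N}}\beta\Big(\big[U_{k,m}^{n,t}(\Delta)\big]_{m\leq M-1},U_{k,M}^{n,t}(\Delta)\Big)$$ (it depends on $n$ and on the partition). The underlying probability space is assumed rich enough to support additional independent uniform random variables. *)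

(* Defs.v *)
From HB Require Import structures.
From mathcomp Require Export all_boot all_order all_algebra.
From mathcomp Require Export finmap.
From mathcomp Require Export all_classical all_reals all_analysis.
From mathcomp Require Export measurable_realfun.

Set Implicit Arguments.
Unset Strict Implicit.
Unset Printing Implicit Defensive.

Import Order.TTheory GRing.Theory Num.Theory.
Import numFieldNormedType.Exports.

Local Open Scope classical_set_scope.
Local Open Scope ring_scope.

(* Vertices are numbered from 0.  An undirected pair {i, j} is represented by
   its increasing representative (i, j), i < j. *)
Definition link (directed : bool) (n : nat) : finType :=
  {p : 'I_n * 'I_n | if directed then p.1 != p.2 else (p.1 < p.2)%N}.

Definition nb_links (directed : bool) (n : nat) : nat := #|link directed n|.

Record is_emetric (R : realType) (L : Type) (d : L -> L -> \bar R) : Prop := {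
  emetric_ge0 : forall u v, (0 <= d u v)%E;
  emetric_eq0 : forall u v, d u v = 0%E <-> u = v;
  emetric_sym : forall u v, d u v = d v u;
  emetric_triangle : forall u v w, (d u w <= d u v + d v w)%E }.

(* A realisation of a Delta-partition with K block types, for a metric d on the
   links.  Types and blocks are numbered from 0: G(k,m) with 1 <= k <= K and
   1 <= m is [G (k-1) (m-1)], and emptiness for m > r_n = #|L| becomes
   emptiness for #|L| <= m.  The blocks need not cover L. *)
Record is_delta_partition (R : realType) (L : finType) (d : L -> L -> \bar R)
    (Delta : R) (K : nat) (G : 'I_K -> nat -> {set L}) : Prop := {
  dpart_disjoint : forall (k k' : 'I_K) (m m' : nat),
    (k, m) <> (k', m') -> G k m :&: G k' m' = finset.set0;
  dpart_separated : forall (k : 'I_K) (m m' : nat) (u v : L),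
    m <> m' -> u \in G k m -> v \in G k m' -> (Delta%:E <= d u v)%E;
  dpart_numbering : forall (k : 'I_K) (m : nat),
    (#|L| <= m)%N -> G k m = finset.set0 }.

Section probability_notions.
Context (disp : measure_display) (Omega : measurableType disp) (R : realType).
Variable P : probability Omega R.

(* P_{A (x) B}: the law of w |-> (w, w) on Omega * Omega.  Together with
   [P \x P] it is used below on the product sigma-field of A and B only. *)
Definition diagonal_law : set (Omega * Omega) -> \bar R :=
  pushforward P (fun w : Omega => (w, w)).

Lemma diagonal_lawX (A B : set Omega) :
  diagonal_law (A `*` B) = P (A `&` B).
Proof. by []. Qed.

Lemma product_lawX (A B : set Omega) : measurable A -> measurable B ->
  ((P \x P) (A `*` B) = P A * P B)%E.
Proof. exact: product_measure1E. Qed.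

Definition prod_sigma_field (A B : set_system Omega) :
    set_system (Omega * Omega) :=
  <<s [set C | exists2 A1, A A1 & exists2 B1, B B1 & C = A1 `*` B1] >>.

Definition beta_mixing (A B : set_system Omega) : R :=
  sup [set `|fine (diagonal_law C) - fine ((P \x P)%E C)|
      | C in prod_sigma_field A B].

(* [M] is the 1-based block index minus 1: the vector of the preceding blocks is
   (U k 0, ..., U k (M - 1)) and the current block is U k M.  For U k m vanishing
   for all large m, only finitely many M matter and the sup is a maximum. *)
Definition beta_blocks (K : nat) (U : 'I_K -> nat -> Omega -> R) : R :=
  sup [set b | exists (k : 'I_K) (M : nat),
    b = beta_mixing (g_sigma_preimage (fun m : 'I_M => U k m))
                    (g_sigma_algebra_preimage (U k M))].

Definition block_sum (L : finType) (K : nat) (Z : L -> Omega -> R)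
    (G : 'I_K -> nat -> Omega -> {set L}) (k : 'I_K) (m : nat) (w : Omega) : R :=
  \sum_(p : L) Z p w * (p \in G k m w)%:R.

Definition centered_block_sum (L : finType) (K : nat) (Z : L -> Omega -> R)
    (G : 'I_K -> nat -> Omega -> {set L}) (k : 'I_K) (m : nat) (w : Omega) : R :=
  \sum_(p : L) (Z p w * (p \in G k m w)%:R
    - fine 'E_P[(fun w' => Z p w' * (p \in G k m w')%:R)%R]).

Definition mutually_independent (I : choiceType)
    (F : I -> set_system Omega) : Prop :=
  forall (J : {fset I}) (A : I -> set Omega),
    (forall i, i \in J -> F i (A i)) ->
    P (\bigcap_(i in [set` J]) A i) = (\prod_(i <- J) P (A i))%E.

(* P supports an independent sequence of uniform variables on [0, 1] that is
   also independent of the sigma-field generated by the events in D. *)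
Definition supports_uniforms (D : set_system Omega) : Prop :=
  exists V : nat -> {RV P >-> R},
    (forall i (B : set R), measurable B ->
       distribution P (V i) B = uniform_prob (@ltr01 R) B) /\
    mutually_independent (fun o : option nat =>
       if o is Some i then g_sigma_algebra_preimage (V i) else <<s D >>).

End probability_notions.

Section network_events.
Context (disp : measure_display) (Omega : measurableType disp) (R : realType).
Variables (L : nat -> finType) (K : nat -> nat) (T : R).
Variables (Z : forall n, L n -> Omega -> R)
  (d : forall (s : R) n, L n -> L n -> Omega -> \bar R)
  (G : forall n, 'I_(K n) -> nat -> Omega -> {set L n}).

Definition network_events : set_system Omega :=
  [set A | (exists n p, g_sigma_algebra_preimage (Z (n := n) p) A)
        \/ (exists s n u v, 0 <= s <= T
              /\ g_sigma_algebra_preimage (d s (n := n) u v) A)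
        \/ (exists n k m p, A = [set w | p \in G (n := n) k m w])].

End network_events.

(* Main.v *)
Require Import Defs.
From mathcomp Require Import ring lra.

(* No coupling is needed: the exponential Markov bound itself is decoupled.
   Suppose P(S_M >= a) <= exp(- l a) phi_1 ... phi_M + M beta for all a, with
   phi_m bounding the Laplace transform of U_m at l.  Replacing the joint law of
   (S_M, U_(M+1)) by the product of its marginals costs at most beta, and
   integrating the bound at a - U_(M+1) over U_(M+1) gives the same bound for
   M + 1.  The moment condition makes phi_m = exp(l^2 v_m / (2 (1 - l b))), and
   l = y / (V + b y) yields Bernstein's inequality for each block type.  The
   block types are combined by a union bound, type k receiving the share
   V_k / |E| of the threshold; only this share and c2 <= V_k / |E| enter the
   exponent. *)

Set Implicit Arguments.
Unset Strict Implicit.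
Unset Printing Implicit Defensive.

Import Order.TTheory GRing.Theory Num.Theory.
Import numFieldNormedType.Exports.

Local Open Scope classical_set_scope.
Local Open Scope ring_scope.

(** * Mixing coefficients and a decoupled exponential Markov bound *)

Section mixing.
Context (disp : measure_display) (Omega : measurableType disp) (R : realType).
Variable P : probability Omega R.

Lemma prod_sigma_field_measurable (A B : set_system Omega) :
  A `<=` measurable -> B `<=` measurable ->
  prod_sigma_field A B `<=` measurable.
Proof.
move=> mA mB; apply: smallest_sub; first exact: sigma_algebra_measurable.
by move=> _ [A1 /mA mA1 [B1 /mB mB1 ->]]; exact: measurableX.
Qed.

(** The complement [f + g < a] is the union, over rational [q], of the rectangles given by [f < q]
    and [g < a - q]. Membership in the ambient product sigma-field would not do: [beta_mixing]
    controls only events in the field generated by rectangles from [A] and [B]. *)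
Lemma prod_sigma_field_tail (A B : set_system Omega) (f g : Omega -> R)
    (a : R) :
  (forall q, A [set w | f w < q]) -> (forall q, B [set w | g w < q]) ->
  prod_sigma_field A B [set z | a <= f z.1 + g z.2].
Proof.
move=> fA gB.
have -> : [set z : Omega * Omega | a <= f z.1 + g z.2] =
    ~` \bigcup_(q : rat)
      ([set w | f w < ratr q] `*` [set w | g w < a - ratr q]).
  apply/seteqP; split=> [z /= az [q _ [/= fq gq]]|z /= nz].
    by move: az; rewrite leNgt; apply/negP/negPn; lra.
  rewrite leNgt; apply/negP => fga; apply: nz.
  have : f z.1 < a - g z.2 by lra.
  move=> /rat_in_itvoo[q]; rewrite in_itv/= => /andP[? ?].
  by exists q => //; split => //=; lra.
apply: sigma_algebraC.
(* The countable union is taken in [Omega * Omega] re-equipped with the generated sigma-field. *)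
apply: (@bigcupT_measurable_rat _ (g_sigma_algebraType
  [set C | exists2 A1, A A1 & exists2 B1, B B1 & C = A1 `*` B1])) => q.
by apply: sub_sigma_algebra; exists [set w | f w < ratr q] => //;
  exists [set w | g w < a - ratr q].
Qed.

Lemma measurable_diagonal_preimage (C : set (Omega * Omega)) :
  measurable C -> measurable ((fun w : Omega => (w, w)) @^-1` C).
Proof.
move=> mC; rewrite -[X in measurable X]setTI.
by apply: (measurable_fun_pair (@measurable_id _ _ _) (@measurable_id _ _ _)).
Qed.

(** A real [sup] is meaningful only for a set bounded above. Both laws take values between 0 and 1
    on measurable sets, so their differences do not exceed 1 in absolute value. *)
Lemma beta_mixing_has_ubound (A B : set_system Omega) :
  A `<=` measurable -> B `<=` measurable ->
  ubound [set `|fine (diagonal_law P C) - fine ((P \x P)%E C)|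
      | C in prod_sigma_field A B] 1.
Proof.
move=> mA mB _ [C /(prod_sigma_field_measurable mA mB) mC <-].
have mdiag := measurable_diagonal_preimage mC.
have fine01 (e : \bar R) : (0 <= e)%E -> (e <= 1)%E -> 0 <= fine e <= 1.
  by case: e => [r|//|//]; rewrite !lee_fin /= => -> ->.
have /andP[d0 d1] := fine01 _ (measure_ge0 P _) (probability_le1 P mdiag).
have /andP[p0 p1] := fine01 _ (measure_ge0 (P \x P)%E _)
  (probability_le1 (P \x P)%E mC).
by rewrite ler_norml /diagonal_law /pushforward; lra.
Qed.

Lemma diagonal_law_le (A B : set_system Omega) (C : set (Omega * Omega)) :
  A `<=` measurable -> B `<=` measurable -> prod_sigma_field A B C ->
  (diagonal_law P C <= (P \x P) C + (beta_mixing P A B)%:E)%E.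
Proof.
move=> mA mB ABC; have mC := prod_sigma_field_measurable mA mB ABC.
have dfin : diagonal_law P C \is a fin_num.
  exact: (fin_num_measure P _ (measurable_diagonal_preimage mC)).
have pfin : (P \x P)%E C \is a fin_num.
  rewrite ge0_fin_numE; last exact: (measure_ge0 (P \x P)%E).
  exact: le_lt_trans (probability_le1 (P \x P)%E mC) (ltry 1).
rewrite -(fineK dfin) -(fineK pfin) -EFinD lee_fin -lerBlDl.
apply: le_trans (ler_norm _) _; apply: ub_le_sup; last by exists C.
by exists 1; exact: beta_mixing_has_ubound.
Qed.

Lemma beta_mixing_le1 (A B : set_system Omega) :
  A `<=` measurable -> B `<=` measurable -> beta_mixing P A B <= 1.
Proof.
move=> mA mB; apply: ge_sup; last exact: beta_mixing_has_ubound.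
by eexists; exists set0 => //; exact: sigma_algebra0.
Qed.

Lemma g_sigma_preimage_measurable M (U : 'I_M -> Omega -> R) :
  (forall m, measurable_fun setT (U m)) -> g_sigma_preimage U `<=` measurable.
Proof.
move=> mU; apply: smallest_sub; first exact: sigma_algebra_measurable.
elim/big_ind : _ => [//|F1 F2 ? ?|i _]; first by rewrite subUset.
by move=> _ [B mB <-]; exact: mU.
Qed.

Lemma g_sigma_algebra_preimage_measurable (X : Omega -> R) :
  measurable_fun setT X -> g_sigma_algebra_preimage X `<=` measurable.
Proof. by move=> mX _ [B mB <-]; exact: mX. Qed.

(** [Omega] is re-equipped with the sigma-field generated by the [U m]. Each [U m] is measurable for
    it by construction, hence so is the finite sum. *)
Lemma g_sigma_preimage_sum M (U : 'I_M -> Omega -> R) q :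
  g_sigma_preimage U [set w | \sum_(m < M) U m w < q].
Proof.
pose G := \big[setU/set0]_(i < M) preimage_set_system setT (U i) measurable.
have mU m : measurable_fun setT (U m : g_sigma_algebraType G -> R).
  move=> _ B mB; apply: sub_sigma_algebra; rewrite /G (bigD1 m)//=.
  by left; exists B.
have : measurable_fun setT
    (fun w : g_sigma_algebraType G => \sum_(m < M) U m w).
  exact: measurable_sum.
move=> /(_ measurableT _ (measurable_itv `]-oo, q[)); rewrite setTI.
by rewrite (_ : _ @^-1` _ = [set w | \sum_(m < M) U m w < q])//;
  apply/seteqP; split=> w /=; rewrite in_itv.
Qed.

(** All the coefficients are at most 1, so the [sup] over types and blocks is genuine, and a single
    number can be charged at every step of the decoupling. *)
Lemma beta_mixing_le_blocks (K : nat) (U : 'I_K -> nat -> Omega -> R) k M :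
  (forall k m, measurable_fun setT (U k m)) ->
  beta_mixing P (g_sigma_preimage (fun m : 'I_M => U k m))
    (g_sigma_algebra_preimage (U k M)) <= beta_blocks P U.
Proof.
move=> mU; apply: ub_le_sup; last by exists k, M.
exists 1 => _ [k' [M' ->]]; apply: beta_mixing_le1.
  exact: g_sigma_preimage_measurable.
exact: g_sigma_algebra_preimage_measurable.
Qed.

Lemma beta_mixing_ge0 (A B : set_system Omega) :
  A `<=` measurable -> B `<=` measurable -> 0 <= beta_mixing P A B.
Proof.
move=> mA mB; apply: ub_le_sup.
  by exists 1; exact: beta_mixing_has_ubound.
exists set0; first exact: sigma_algebra0.
by rewrite (measure0 (P \x P)%E) /diagonal_law /pushforward preimage_set0
  measure0 subrr normr0.
Qed.

Lemma measurable_tail_sum (S X : Omega -> R) (a : R) :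
  measurable_fun setT S -> measurable_fun setT X ->
  measurable [set z : Omega * Omega | a <= S z.1 + X z.2].
Proof.
move=> mS mX.
have mf : measurable_fun setT (fun z : Omega * Omega => S z.1 + X z.2).
  by apply: measurable_funD; exact: measurableT_comp.
have := mf measurableT _ (measurable_itv `[a, +oo[); rewrite setTI.
by congr measurable; apply/seteqP; split=> z /=; rewrite in_itv/= andbT.
Qed.

(** By uniqueness of the product measure the integration may be done in the order that freezes the
    second coordinate. The inner probability is then a tail of [S] at a shifted level. *)
Lemma product_tailE (S X : Omega -> R) (a : R) :
  measurable_fun setT S -> measurable_fun setT X ->
  ((P \x P) [set z | (a <= S z.1 + X z.2)%R] =
    \int[P]_w P [set v | (a - X w <= S v)%R])%E.
Proof.
move=> mS mX.
have mC := measurable_tail_sum a mS mX.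
rewrite (@product_measure_unique _ _ _ _ _ P P (P \x^ P)%E)//; last first.
  by move=> A B mA mB; exact: product_measure2E.
rewrite /product_measure2; apply: eq_integral => w _ /=; congr (P _).
by apply/seteqP; split=> v; rewrite /ysection/= inE/= lerBlDr.
Qed.

(** Induction on [M], with the level [a] kept universal because the induction hypothesis is used
    under the integral at the random level [a - U M w]. Each decoupling adds one [b] to the
    error. *)
Lemma tail_sum_le (U : nat -> Omega -> R) (phi : nat -> R) (l b : R) :
  (forall m, measurable_fun setT (U m)) -> 0 <= l ->
  (forall M, beta_mixing P (g_sigma_preimage (fun m : 'I_M => U m))
    (g_sigma_algebra_preimage (U M)) <= b) ->
  forall M, (forall m, (m < M)%N ->
    (\int[P]_w (expR (l * U m w))%:E <= (phi m)%:E)%E) ->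
  forall a, (P [set w | (a <= \sum_(m < M) U m w)%R] <=
    (expR (- (l * a)) * \prod_(m < M) phi m + M%:R * b)%:E)%E.
Proof.
move=> mU l0 bU; elim=> [|M IH] phiU a.
  (* With no summand the event is sure when [a <= 0], where the exponential is at least 1, and empty
     when [a > 0]. *)
  rewrite !big_ord0 mulr1 mul0r addr0.
  have [a0|a0] := leP a 0.
    rewrite (_ : [set _ | _] = setT); last first.
      by apply/seteqP; split=> w //= _; rewrite big_ord0.
    by rewrite probability_setT lee_fin -expR0 ler_expR oppr_ge0 mulr_ge0_le0.
  rewrite (_ : [set _ | _] = set0) ?measure0 ?lee_fin ?expR_ge0//.
  by apply/seteqP; split=> w //=; rewrite big_ord0 leNgt a0.
have mpast := g_sigma_preimage_measurable (fun m : 'I_M => mU m).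
have mlast := g_sigma_algebra_preimage_measurable (mU M).
have b0 : 0 <= b.
  by apply: le_trans (bU M); exact: beta_mixing_ge0.
set S := fun w => \sum_(m < M) U m w.
have mS : measurable_fun setT S by exact: measurable_sum.
have phi0 m : (m < M.+1)%N -> 0 <= phi m.
  move=> mM; rewrite -lee_fin; apply: le_trans (phiU _ mM).
  by apply: integral_ge0 => w _; rewrite lee_fin expR_ge0.
set pi := \prod_(m < M) phi m.
have pi0 : 0 <= pi by apply: prodr_ge0 => m _; apply: phi0; rewrite leqW.
set C := [set z : Omega * Omega | a <= S z.1 + U M z.2].
have -> : [set w | a <= \sum_(m < M.+1) U m w] = (fun w => (w, w)) @^-1` C.
  by apply/seteqP; split=> w /=; rewrite big_ord_recr.
have : prod_sigma_field (g_sigma_preimage (fun m : 'I_M => U m))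
    (g_sigma_algebra_preimage (U M)) C.
  apply: prod_sigma_field_tail => q; first exact: g_sigma_preimage_sum.
  exists `]-oo, q[%classic; first exact: measurable_itv.
  by rewrite setTI; apply/seteqP; split=> w /=; rewrite in_itv.
move=> /(diagonal_law_le mpast mlast)/le_trans; apply.
rewrite /C product_tailE//.
have mX : measurable_fun setT (fun w => (expR (l * U M w))%:E).
  apply/measurable_EFinP; apply: measurableT_comp => /=.
    exact: measurable_expR.
  exact: measurable_funM.
have c0 : 0 <= expR (- (l * a)) * pi by rewrite mulr_ge0// expR_ge0.
(* The hypothesis at level [a - U M w] splits multiplicatively: [expR (- (l * (a - U M w)))] is
   [expR (- (l * a))] times [expR (l * U M w)], and the latter integrates to at most [phi M]. *)
have le1 : (\int[P]_w P [set v | (a - U M w <= S v)%R] <=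
    \int[P]_w ((expR (- (l * a)) * pi)%:E * (expR (l * U M w))%:E
      + (M%:R * b)%:E))%E.
  apply: ge0_le_integral => //.
  - have mC : measurable C by exact: measurable_tail_sum.
    have := measurable_fun_ysection P mC.
    by congr measurable_fun; apply/funext => w /=; congr (P _);
      apply/seteqP; split=> v; rewrite /ysection/= inE/= lerBlDr.
  - by apply: emeasurable_funD => //; exact: measurable_funeM.
  - move=> w _; apply: le_trans (IH _ _) _.
      by move=> m mM; apply: phiU; rewrite leqW.
    rewrite -EFinM -EFinD lee_fin mulrBr opprB addrC [l * _ - _]addrC.
    by rewrite expRD addrC mulrAC.
apply: le_trans (leeD2r _ le1) _.
rewrite ge0_integralD//=; first last.
- by move=> w _; rewrite lee_fin mulr_ge0.
- exact: measurable_funeM.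
- by move=> w _; rewrite lee_fin mulr_ge0// expR_ge0.
rewrite ge0_integralZl//.
rewrite integral_cst//= probability_setT mule1.
rewrite big_ord_recr/= -/pi.
apply: le_trans (_ : (_ <= (expR (- (l * a)) * pi)%:E * (phi M)%:E
    + (M%:R * b)%:E + b%:E)%E) _.
  apply: leeD; last by rewrite lee_fin; exact: bU.
  by apply: leeD2r; apply: lee_wpmul2l; rewrite ?lee_fin// phiU.
by rewrite -EFinM -!EFinD lee_fin -natr1; lra.
Qed.

End mixing.

(** * Laplace transforms under the Bernstein moment condition *)

Section mgf.
Context (disp : measure_display) (Omega : measurableType disp) (R : realType).
Variable P : probability Omega R.

(** The exponential series without its terms of degree 0 and 1 is bounded term by term by absolute
    values. Stated as an extended-real series of nonnegative terms, the bound can be integrated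
    termwise with no convergence checked beforehand. *)
Lemma expR_sub1Dx_le (u : R) :
  ((expR u - (1 + u))%:E <=
    \sum_(0 <= k <oo) (`|u| ^+ k.+2 / k.+2`!%:R)%:E)%E.
Proof.
set S := (X in (_ <= X)%E).
have termge0 k : (0 <= (`|u| ^+ k.+2 / k.+2`!%:R)%:E)%E.
  by rewrite lee_fin divr_ge0.
have partial n : ((series (exp_coeff u) n.+2 - (1 + u))%:E <= S)%E.
  apply: le_trans (nneseries_lim_ge n _); last by move=> *; exact: termge0.
  rewrite sumEFin/= lee_fin /series/= !big_nat_recl//= /exp_coeff/=.
  rewrite expr0 expr1 !fact0 divr1 divr1 addrA addrC addrK.
  by apply: ler_sum => k _; rewrite ler_wpM2r// -normrX ler_norm.
have : (S != -oo)%E.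
  by rewrite gt_eqF// (lt_le_trans _ (nneseries_ge0 _))// => *.
(* An infinite sum makes the bound trivial; for a finite one, the real bounds on partial sums pass
   to the limit. *)
move SE : S partial => [s|//|//] partial _; last exact: leey.
rewrite lee_fin lerBlDr -[X in _ <= X]/(s + (1 + u)).
apply: limr_le; first exact: is_cvg_series_exp_coeff.
near=> n; have nE : n = n.-2.+2 by near: n; exists 2%N => // -[|[|]].
by rewrite nE -lerBlDr -lee_fin partial.
Unshelve. all: by end_near. Qed.

Lemma nneseries_geometric (a z : R) : 0 <= a -> 0 <= z < 1 ->
  (\sum_(0 <= k <oo) (a * z ^+ k)%:E = (a / (1 - z))%:E)%E.
Proof.
move=> a0 /andP[z0 z1]; apply/cvg_lim => //.
rewrite (_ : (fun n => _) = EFin \o series (geometric a z)); last first.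
  by apply/funext => n; rewrite /= /series/= sumEFin.
apply: cvg_EFin; first by near=> n.
by apply: cvg_geometric_series; rewrite ger0_norm.
Unshelve. all: by end_near. Qed.

(** Centering removes the linear term of the exponential. The moment bounds turn the remaining
    series into a geometric one of ratio [l * b], and [1 + c <= expR c] concludes. *)
Lemma mgf_le (X : Omega -> R) (v b l : R) :
  measurable_fun setT X -> P.-integrable setT (EFin \o X) ->
  (\int[P]_w (X w)%:E = 0)%E ->
  0 <= v -> 0 <= b -> 0 <= l -> l * b < 1 ->
  (forall rho, (2 <= rho)%N ->
    (\int[P]_w (`|X w| ^+ rho)%:E <=
       (rho`!%:R / 2 * v * b ^+ (rho - 2))%:E)%E) ->
  (\int[P]_w (expR (l * X w))%:E <=
    (expR (l ^+ 2 * v / (2 * (1 - l * b))))%:E)%E.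
Proof.
move=> mX iX X0 v0 b0 l0 lb1 mom.
have mlX : measurable_fun setT (fun w => l * X w) by exact: measurable_funM.
(* As [h] is nonnegative, its integral can be estimated before integrability of the exponential is
   known; the finite estimate [hle] then yields the integrability of [h]. *)
pose h w := expR (l * X w) - (1 + l * X w).
have h0 w : 0 <= h w by rewrite subr_ge0 expR_ge1Dx.
have mh : measurable_fun setT h.
  apply: measurable_funB; last exact: measurable_funD.
  by apply: measurableT_comp => //=; exact: measurable_expR.
have mterm k : measurable_fun setT
    (fun w => (`|l * X w| ^+ k.+2 / k.+2`!%:R)%:E).
  apply/measurable_EFinP; apply: measurable_funM => //.
  by apply: measurable_funX; exact: measurableT_comp.
have term0 k w : (0 <= (`|l * X w| ^+ k.+2 / k.+2`!%:R)%:E)%E.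
  by rewrite lee_fin divr_ge0.
have hle : (\int[P]_w (h w)%:E <= (l ^+ 2 * v / (2 * (1 - l * b)))%:E)%E.
  apply: (@le_trans _ _
    (\int[P]_w \sum_(0 <= k <oo) (`|l * X w| ^+ k.+2 / k.+2`!%:R)%:E)%E).
    apply: ge0_le_integral => //.
    - by move=> w _; rewrite lee_fin.
    - exact/measurable_EFinP.
    - exact: ge0_emeasurable_sum.
    - by move=> w _; exact: expR_sub1Dx_le.
  rewrite integral_nneseries//.
  have -> : l ^+ 2 * v / (2 * (1 - l * b)) = (l ^+ 2 * v / 2) / (1 - l * b).
    by rewrite invfM mulrA.
  rewrite -nneseries_geometric; last 2 first.
  - by rewrite divr_ge0// mulr_ge0// exprn_ge0.
  - by rewrite mulr_ge0.
  apply: lee_nneseries => [k _ _|k _]; first by apply: integral_ge0.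
  have -> : (\int[P]_w (`|l * X w| ^+ k.+2 / k.+2`!%:R)%:E =
      (l ^+ k.+2 / k.+2`!%:R)%:E * \int[P]_w (`|X w| ^+ k.+2)%:E)%E.
    rewrite -ge0_integralZl//; last 2 first.
    - by apply/measurable_EFinP/measurable_funX; exact: measurableT_comp.
    - by rewrite lee_fin divr_ge0// exprn_ge0.
    apply: eq_integral => w _; rewrite -EFinM normrM exprMn (ger0_norm l0).
    by rewrite mulrAC.
  apply: le_trans (lee_wpmul2l _ (mom k.+2 _)) _ => //.
    by rewrite lee_fin divr_ge0// exprn_ge0.
  (* The factorials cancel, leaving [l ^+ 2 * v / 2] times [(l * b) ^+ k] on both sides. *)
  rewrite -EFinM lee_fin subn2/= le_eqVlt; apply/orP; left; apply/eqP.
  have fact_neq0 : k.+2`!%:R != 0 :> R by rewrite pnatr_eq0 -lt0n fact_gt0.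
  by rewrite exprMn !exprS; field.
have ih : P.-integrable setT (EFin \o h).
  apply/integrableP; split; first exact/measurable_EFinP.
  under eq_integral do rewrite /= ger0_norm//.
  exact: le_lt_trans hle (ltry _).
have i1X : P.-integrable setT (fun w => (1 + l * X w)%:E).
  have := integrableD measurableT
    (finite_measure_integrable_cst P 1 measurableT)
    (integrableZl measurableT l iX).
  by apply: eq_integrable => // w _; rewrite /= EFinD EFinM.
have -> : (\int[P]_w (expR (l * X w))%:E =
    \int[P]_w ((h w)%:E + (1 + l * X w)%:E))%E.
  by apply: eq_integral => w _; rewrite -EFinD subrK.
rewrite integralD//.
have -> : (\int[P]_w (1 + l * X w)%:E = 1)%E.
  under eq_integral do rewrite EFinD EFinM.
  rewrite integralD//=; last 2 first.
  - exact: (finite_measure_integrable_cst P 1 measurableT).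
  - exact: integrableZl.
  by rewrite integralZl// X0 mule0 adde0 integral_cst//= probability_setT mule1.
apply: le_trans (leeD2r _ hle) _.
by rewrite -EFinD lee_fin addrC expR_ge1Dx.
Qed.
End mgf.

(** * Bernstein's inequality with a mixing error, and its exponent *)

Section bernstein.
Context (disp : measure_display) (Omega : measurableType disp) (R : realType).
Variable P : probability Omega R.

(** For [l = y / (V + b * y)] one has [1 - l * b = V / (V + b * y)]. The exponent
    [- l * y + l ^+ 2 * V / (2 * (1 - l * b))] then collapses to the stated one. *)
Lemma bernstein_mixing (U : nat -> Omega -> R) (M : nat) (v : 'I_M -> R)
    (b beta y : R) :
  let V := \sum_(m < M) v m in
  (forall m, measurable_fun setT (U m)) ->
  (forall m, P.-integrable setT (EFin \o U m)) ->
  (forall m, (\int[P]_w (U m w)%:E = 0)%E) ->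
  (forall N, beta_mixing P (g_sigma_preimage (fun m : 'I_N => U m))
    (g_sigma_algebra_preimage (U N)) <= beta) ->
  (forall m, 0 <= v m) -> 0 < V -> 0 <= b -> 0 < y ->
  (forall (m : 'I_M) rho, (2 <= rho)%N ->
    (\int[P]_w (`|U m w| ^+ rho)%:E <=
       (rho`!%:R / 2 * v m * b ^+ (rho - 2))%:E)%E) ->
  (P [set w | (y <= \sum_(m < M) U m w)%R] <=
    (expR (- (y ^+ 2 / (2 * (V + b * y)))) + M%:R * beta)%:E)%E.
Proof.
move=> V mU iU U0 Ubeta v0 V0 b0 y0 mom.
have D0 : 0 < V + b * y by rewrite ltr_wpDr// mulr_ge0// ltW.
have l0 : 0 <= y / (V + b * y) by rewrite divr_ge0// ltW.
have lb1 : y / (V + b * y) * b < 1.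
  by rewrite mulrAC ltr_pdivrMr// mul1r; lra.
set l := y / (V + b * y) in l0 lb1.
pose c := l ^+ 2 / (2 * (1 - l * b)).
(* [tail_sum_le] expects a sequence indexed by [nat], so the factors are extended by the default
   value 1 beyond [M]. *)
pose phi m := oapp (fun i : 'I_M => expR (c * v i)) 1 (insub m).
apply: le_trans (@tail_sum_le _ _ _ P U phi l beta mU l0 Ubeta M _ y) _.
  move=> m mM; rewrite /phi insubT/=.
  apply: le_trans
    (@mgf_le _ _ _ P (U m) (v (Ordinal mM)) b l _ _ _ _ _ _ _ _) _ => //.
    by move=> rho rho2; exact: (mom (Ordinal mM)).
  by rewrite /c mulrAC.
rewrite (eq_bigr (fun m => expR (c * v m))); last first.
  by move=> m _; rewrite /phi valK.
rewrite -expR_sum -mulr_sumr -/V -expRD lee_fin lerD2r ler_expR.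
have lbE : 1 - l * b = V / (V + b * y) by rewrite /l; field; rewrite gt_eqF.
rewrite /c lbE /l le_eqVlt; apply/orP; left; apply/eqP; field.
by rewrite !gt_eqF.
Qed.

(** Here [w] is the share of one block type in the total weight, [L] the logarithm of that weight,
    and [L * q ^+ 2] the weight itself. Raising [e] to [c3 * q] only enlarges the denominator; the
    quotient then simplifies to the left side with [w] in place of [c2]. *)
Lemma bernstein_exponent_le (w x L q e s c1 c2 c3 : R) :
  0 < x -> 0 < L -> 0 < q -> 0 < s -> 0 < c1 -> 0 < c2 -> 0 < c3 ->
  c2 <= w -> 0 < e <= c3 * q ->
  c2 * x ^+ 2 / (2 * (s + c1 * c3 * x)) * L <=
    (w * (x * L * q)) ^+ 2 /
      (2 * (w * (L * q ^+ 2) * s + e * c1 * (w * (x * L * q)))).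
Proof.
move=> x0 L0 q0 s0 c10 c20 c30 c2w /andP[e0 ecq].
have w0 : 0 < w by exact: lt_le_trans c2w.
have d0 : 0 < s + c1 * c3 * x by rewrite addr_gt0// !mulr_gt0.
have y0 : 0 < w * (x * L * q) by rewrite !mulr_gt0.
have v0 : 0 < w * (L * q ^+ 2) * s by rewrite !mulr_gt0// exprn_gt0.
have -> : c2 * x ^+ 2 / (2 * (s + c1 * c3 * x)) * L =
    (c2 / w) * ((w * (x * L * q)) ^+ 2 /
      (2 * (w * (L * q ^+ 2) * s + c3 * q * c1 * (w * (x * L * q))))).
  have -> : w * (L * q ^+ 2) * s + c3 * q * c1 * (w * (x * L * q)) =
    w * L * q ^+ 2 * (s + c1 * c3 * x) by ring.
  by field; rewrite !gt_eqF.
have D0 : 0 < w * (L * q ^+ 2) * s + c3 * q * c1 * (w * (x * L * q)).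
  by rewrite addr_gt0// !mulr_gt0.
set A := (X in c2 / w * X).
have A0 : 0 < A by rewrite divr_gt0 ?exprn_gt0// mulr_gt0.
apply: (@le_trans _ _ A).
  by apply: ler_piMl; [exact: ltW|rewrite ler_pdivrMr// mul1r].
rewrite ler_pM2l ?exprn_gt0// lef_pV2 ?posrE ?mulr_gt0//; last first.
  by rewrite addr_gt0// !mulr_gt0.
by rewrite ler_pM2l// lerD2l ler_pM2r// ler_pM2r.
Qed.

Lemma probability_bigsetU_le (I : Type) (s : seq I) (F : I -> set Omega) :
  (forall i, measurable (F i)) ->
  (P (\big[setU/set0]_(i <- s) F i) <= \sum_(i <- s) P (F i))%E.
Proof.
move=> mF; elim: s => [|i s IH]; first by rewrite !big_nil measure0.
rewrite !big_cons; apply: le_trans (leeD2l _ IH).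
by apply: measureU2 => //; exact: bigsetU_measurable.
Qed.

End bernstein.

(** * Integrability and centering of the block sums *)

Section blocks.
Context (disp : measure_display) (Omega : measurableType disp) (R : realType).
Variable P : probability Omega R.

Lemma expectationE (X : Omega -> R) : ('E_P[X] = \int[P]_w (X w)%:E)%E.
Proof. by rewrite unlock. Qed.

Lemma fine_expectation_sum (I : finType) (X : I -> Omega -> R) :
  (forall i, P.-integrable setT (EFin \o X i)) ->
  fine 'E_P[fun w => (\sum_i X i w)%R] = \sum_i fine 'E_P[X i].
Proof.
move=> iX; under [in RHS]eq_bigr do rewrite expectationE.
rewrite expectationE; under eq_integral do rewrite -sumEFin.
rewrite integral_sum// -sum_fine// => i _.
exact: (integrable_fin_num measurableT (iX i)).
Qed.

Variables (L : finType) (K : nat) (Z : L -> Omega -> R)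
  (G : 'I_K -> nat -> Omega -> {set L}).
Hypothesis mZ : forall p, measurable_fun setT (Z p).
Hypothesis iZ : forall p, P.-integrable setT (EFin \o Z p).
Hypothesis mG : forall k m p, measurable [set w | p \in G k m w].

Lemma measurable_restricted k m p :
  measurable_fun setT (fun w => Z p w * (p \in G k m w)%:R).
Proof.
apply: measurable_funM => //.
rewrite (_ : (fun w => _) = \1_[set w | p \in G k m w]).
  exact: measurable_indic.
by apply/funext => w; rewrite indicE; congr (_%:R); rewrite mem_setE.
Qed.

Lemma integrable_restricted k m p :
  P.-integrable setT (fun w => (Z p w * (p \in G k m w)%:R)%:E).
Proof.
apply: (le_integrable measurableT _ _ (iZ p)).
  exact/measurable_EFinP/measurable_restricted.
move=> w _; rewrite lee_fin normrM; case: (p \in _).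
  by rewrite normr1 mulr1.
by rewrite normr0 mulr0.
Qed.

Lemma integrable_centered_restricted k m p :
  P.-integrable setT (fun w => (Z p w * (p \in G k m w)%:R
    - fine 'E_P[(fun w' => Z p w' * (p \in G k m w')%:R)%R])%:E).
Proof.
have := integrableB measurableT (integrable_restricted k m p)
  (finite_measure_integrable_cst P
    (fine 'E_P[(fun w' => Z p w' * (p \in G k m w')%:R)%R]) measurableT).
by apply: eq_integrable => // w _; rewrite /= EFinB.
Qed.

Let U := centered_block_sum P Z G.

Lemma measurable_centered_block_sum k m : measurable_fun setT (U k m).
Proof.
apply: measurable_sum => p; apply: measurable_funB => //.
exact: measurable_restricted.
Qed.

Lemma integrable_centered_block_sum k m :
  P.-integrable setT (EFin \o U k m).
Proof.
have := integrable_sum measurableT (index_enum L) (P := xpredT)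
  (fun p _ => integrable_centered_restricted k m p).
by apply: eq_integrable => // w _; rewrite /= sumEFin.
Qed.

Lemma integral_centered_block_sum k m : (\int[P]_w (U k m w)%:E = 0)%E.
Proof.
under eq_integral do rewrite /U /centered_block_sum -sumEFin.
rewrite integral_sum//; last exact: integrable_centered_restricted.
apply: big1 => p _; under eq_integral do rewrite EFinB.
rewrite integralB//=; last 2 first.
- exact: integrable_restricted.
- exact: finite_measure_integrable_cst.
rewrite integral_cst//= probability_setT mule1 expectationE fineK ?subee//.
  exact: (integrable_fin_num measurableT (integrable_restricted k m p)).
exact: (integrable_fin_num measurableT (integrable_restricted k m p)).
Qed.

(** The two sides are centered by different constants, the means of [Z p] and those of its
    restrictions to blocks. Integrating the almost sure identity shows that the totals of these
    constants agree. *)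
Lemma sum_centered_ae (r : nat) :
  {ae P, forall w, \sum_p Z p w =
    \sum_(k < K) \sum_(m < r) block_sum Z G k m w} ->
  {ae P, forall w, \sum_p (Z p w - fine 'E_P[Z p]) =
    \sum_(k < K) \sum_(m < r) U k m w}.
Proof.
move=> split_ae.
have iB k m : P.-integrable setT (EFin \o block_sum Z G k m).
  have := integrable_sum measurableT (index_enum L) (P := xpredT)
    (fun p _ => integrable_restricted k m p).
  by apply: eq_integrable => // w _; rewrite /= sumEFin.
have iBk k : P.-integrable setT
    (EFin \o (fun w => \sum_(m < r) block_sum Z G k m w)).
  have := integrable_sum measurableT (index_enum 'I_r) (P := xpredT)
    (fun m _ => iB k m).
  by apply: eq_integrable => // w _; rewrite /= sumEFin.
have EE : \sum_p fine 'E_P[Z p] = \sum_(k < K) \sum_(m < r) \sum_p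
    fine 'E_P[(fun w => Z p w * (p \in G k m w)%:R)%R].
  rewrite -fine_expectation_sum//.
  have -> : ('E_P[fun w => (\sum_p Z p w)%R] =
      'E_P[fun w => (\sum_(k < K) \sum_(m < r) block_sum Z G k m w)%R])%E.
    rewrite !expectationE; apply: ae_eq_integral => //.
    - by apply/measurable_EFinP; exact: measurable_sum.
    - apply/measurable_EFinP; apply: measurable_sum => k.
      apply: measurable_sum => m.
      by apply: measurable_sum => p; exact: measurable_restricted.
    - by apply: filterS split_ae => w + _; move=> ->.
  rewrite fine_expectation_sum//; apply: eq_bigr => k _.
  rewrite fine_expectation_sum//; apply: eq_bigr => m _.
  by rewrite fine_expectation_sum// => p; exact: integrable_restricted.
apply: filterS split_ae => w ZE.
rewrite sumrB ZE EE -sumrB; apply: eq_bigr => k _.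
by rewrite -sumrB; apply: eq_bigr => m _; rewrite -sumrB.
Qed.

(** By the numbering convention the blocks of index at least [#|L|] are empty, so the partial sums
    are eventually constant. *)
Lemma split_finite (d : L -> L -> \bar R) (Delta : R) k w :
  is_delta_partition d Delta (fun k m => G k m w) ->
  limn (series (fun m => block_sum Z G k m w)) =
    \sum_(m < #|L|) block_sum Z G k m w.
Proof.
move=> part; apply/cvg_lim => //; apply: cvg_near_cst.
exists #|L| => // n /= Ln; rewrite /series/= (big_cat_nat (n := #|L|))//=.
rewrite big_mkord [X in _ + X]big_nat.
rewrite [X in _ + X]big1 ?addr0// => m /andP[Lm _].
by apply: big1 => p _; rewrite (dpart_numbering part)// inE mulr0.
Qed.

End blocks.

(** * Allocation of the threshold and union bound over the block types *)

Theorem lemma2p15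
  (disp : measure_display) (Omega : measurableType disp) (R : realType)
  (P : probability Omega R)
  (directed : bool) (T t : R) (ht : 0 <= t <= T)
  (d : forall (s : R) (n : nat),
     link directed n -> link directed n -> Omega -> \bar R)
  (d_meas : forall (s : R) (n : nat) (u v : link directed n),
     0 <= s <= T -> measurable_fun [set: Omega] (d s n u v))
  (d_metric : forall (s : R) (n : nat), 0 <= s <= T ->
     {ae P, forall w, is_emetric (fun u v => d s n u v w)})
  (Z : forall n : nat, link directed n -> {RV P >-> R})
  (Z_int : forall (n : nat) (p : link directed n),
     P.-integrable [set: Omega] (fun w => (Z n p w)%:E))
  (Delta : nat -> R) (Delta_gt0 : forall n, 0 < Delta n)
  (K : nat -> nat) (K_gt0 : forall n, (0 < K n)%N)
  (G : forall n : nat, 'I_(K n) -> nat -> Omega -> {set link directed n})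
  (G_meas : forall (n : nat) (k : 'I_(K n)) (m : nat) (p : link directed n),
     measurable [set w | p \in G n k m w])
  (P_rich : supports_uniforms P (network_events T Z d G))
  (G_partition : forall n : nat,
     {ae P, forall w, is_delta_partition (fun u v => d t n u v w) (Delta n)
                        (fun k m => G n k m w)})
  (Z_split : forall n : nat,
     {ae P, forall w, \sum_p Z n p w =
       \sum_(k < K n) limn (series (fun m => block_sum (Z n) (@G n) k m w))})
  (Ekm : forall n : nat, 'I_(K n) -> 'I_(nb_links directed n) -> R)
  (Ekm_gt0 : forall n k m, 0 < Ekm n k m)
  (Ek : forall n : nat, 'I_(K n) -> R)
  (Ek_gt0 : forall n k, 0 < Ek n k)
  (sigma c1 c2 c3 : R)
  (sigma2_gt0 : 0 < sigma ^+ 2) (c1_gt0 : 0 < c1) (c2_gt0 : 0 < c2)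
  (c3_gt0 : 0 < c3) :
  let U n := centered_block_sum P (Z n) (@G n) in
  let absE n := \sum_(k < K n) \sum_(m < nb_links directed n) Ekm n k m in
  forall
  (moments : forall (n rho : nat) (k : 'I_(K n)) (m : 'I_(nb_links directed n)),
     (2 <= rho)%N ->
     ('E_P[(fun w => `|U n k m w| ^+ rho)%R] <=
        (rho`!%:R / 2 * Ekm n k m * sigma ^+ 2
           * (Ek n k * c1) ^+ (rho - 2))%:E)%E)
  (balance : forall (n : nat) (k : 'I_(K n)), (2 <= n)%N ->
     c2 <= (absE n)^-1 * \sum_(m < nb_links directed n) Ekm n k m)
  (Ek_bound : forall (n : nat) (k : 'I_(K n)), (2 <= n)%N ->
     Ek n k <= c3 * Num.sqrt (absE n / ln (absE n))),
  forall (x : R) (n : nat), 0 < x -> (2 <= n)%N ->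
  (P [set w | (x * Num.sqrt (ln (absE n) / absE n) <=
        (absE n)^-1 * \sum_p (Z n p w - fine 'E_P[Z n p]))%R] <=
   ((K n)%:R * absE n `^ (- (c2 * x ^+ 2 / (2 * (sigma ^+ 2 + c1 * c3 * x))))
     + beta_blocks P (U n) * (K n)%:R * (nb_links directed n)%:R)%:E)%E.
Proof.
move=> U absE moments balance Ek_bound x n x0 n2.
have absE_ge0 : 0 <= absE n.
  by apply: sumr_ge0 => k _; apply: sumr_ge0 => m _; exact: ltW.
set q := Num.sqrt (absE n / ln (absE n)).
(* Since [Ek > 0], [Ek_bound] rules out the junk values of [Num.sqrt] and
   division, and so forces [0 < absE n] and [0 < ln (absE n)]. *)
have q0 : 0 < q.
  pose k0 := Ordinal (K_gt0 n).
  have := lt_le_trans (Ek_gt0 n k0) (Ek_bound n k0 n2).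
  by rewrite pmulr_rgt0.
have q2E : q ^+ 2 = absE n / ln (absE n).
  by rewrite sqr_sqrtr// ltW// -sqrtr_gt0.
have E0 : 0 < absE n.
  rewrite lt_neqAle absE_ge0 andbT eq_sym; apply: contraTneq q0 => E0.
  by rewrite /q E0 mul0r sqrtr0 ltxx.
set l := ln (absE n).
have l0 : 0 < l.
  have : 0 < absE n / l by rewrite -q2E exprn_gt0.
  by rewrite pmulr_rgt0// invr_gt0.
have EE : absE n = l * q ^+ 2 by rewrite q2E mulrC divfK// gt_eqF.
pose r := nb_links directed n.
pose v (k : 'I_(K n)) := \sum_(m < r) Ekm n k m.
(* Since [absE n = l * q ^+ 2] and [Num.sqrt (l / absE n) = q^-1], the factor [x * l * q] is the
   threshold for the unnormalised sum. *)
pose y k := (absE n)^-1 * v k * (x * l * q).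
have mZ p : measurable_fun setT (Z n p) by [].
pose S k w := \sum_(m < r) U n k m w.
have mS k : measurable_fun setT (S k).
  apply: measurable_sum => m.
  exact: (measurable_centered_block_sum P mZ (@G_meas n)).
have mtail k : measurable [set w | y k <= S k w].
  have := mS k measurableT _ (measurable_itv `[y k, +oo[); rewrite setTI.
  by congr measurable; apply/seteqP; split=> w /=; rewrite in_itv/= andbT.
have sum_ae : {ae P, forall w, \sum_p (Z n p w - fine 'E_P[Z n p]) =
    \sum_(k < K n) S k w}.
  apply: (sum_centered_ae mZ (Z_int n) (@G_meas n)).
  apply: filterS2 (G_partition n) (Z_split n) => w part ->.
  by apply: eq_bigr => k _; exact: (split_finite (Z n) k part).
have tail k : (P [set w | (y k <= S k w)%R] <=
    (absE n `^ (- (c2 * x ^+ 2 / (2 * (sigma ^+ 2 + c1 * c3 * x))))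
     + r%:R * beta_blocks P (U n))%:E)%E.
  have w0 : c2 <= (absE n)^-1 * v k by exact: balance.
  (* Positivity is drawn from the balance condition, which avoids showing that there is at least one
     link. *)
  have v0 : 0 < v k.
    by have := lt_le_trans c2_gt0 w0; rewrite pmulr_rgt0// invr_gt0.
  have y0 : 0 < y k by rewrite /y !mulr_gt0// invr_gt0.
  have := @bernstein_mixing _ _ _ P (U n k) r
    (fun m => Ekm n k m * sigma ^+ 2) (Ek n k * c1) (beta_blocks P (U n)) (y k).
  rewrite /= -mulr_suml => /(_ _ _ _ _ _ _ _ _ _)/le_trans; apply.
  - by move=> m; exact: (measurable_centered_block_sum P mZ (@G_meas n)).
  - move=> m.
    exact: (integrable_centered_block_sum mZ (Z_int n) (@G_meas n)).
  - by move=> m; exact: (integral_centered_block_sum mZ (Z_int n) (@G_meas n)).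
  - move=> N; apply: beta_mixing_le_blocks => k' m.
    exact: (measurable_centered_block_sum P mZ (@G_meas n)).
  - by move=> m; rewrite mulr_ge0 ?ltW.
  - by rewrite mulr_gt0.
  - by rewrite mulr_ge0 ?ltW.
  - by [].
  - move=> m rho rho2; have := moments n rho k m rho2.
    by rewrite expectationE -[_ * Ekm n k m * _]mulrA.
  (* For the nonzero base [absE n], the power unfolds to [expR] of its exponent times [l], so only
     the exponents remain to be compared. *)
  rewrite lee_fin lerD2r /powR gt_eqF// ler_expR mulNr lerN2.
  have := @bernstein_exponent_le R ((absE n)^-1 * v k) x l q (Ek n k)
    (sigma ^+ 2) c1 c2 c3 x0 l0 q0 sigma2_gt0 c1_gt0 c2_gt0 c3_gt0 w0.
  rewrite Ek_gt0 Ek_bound// => /(_ isT)/le_trans; apply.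
  rewrite -EE -/(y k) [(absE n)^-1 * v k * absE n]mulrAC mulVf ?gt_eqF// mul1r.
  by [].
have [N [mN PN subN]] := sum_ae.
set A := [set w | _].
have mA : measurable A.
  have mf : measurable_fun setT
      (fun w => (absE n)^-1 * \sum_p (Z n p w - fine 'E_P[Z n p])).
    apply: measurable_funM => //; apply: measurable_sum => p.
    exact: measurable_funB.
  have := mf measurableT _
    (measurable_itv `[x * Num.sqrt (l / absE n), +oo[); rewrite setTI.
  by congr measurable; apply/seteqP; split=> w /=; rewrite in_itv/= andbT.
have sumy : \sum_(k < K n) y k = x * l * q.
  by rewrite -mulr_suml -mulr_sumr mulVf ?gt_eqF// mul1r.
(* Off the null set [N], if every [S k] were below [y k], the total would be strictly below
   [x * l * q], contrary to [A]. Strictness of the sum needs at least one block type, hence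
   [K_gt0]. *)
have subA : A `<=` N `|` \big[setU/set0]_(k < K n) [set w | y k <= S k w].
  move=> w /= Aw.
  have [Nw|/(contra_not (@subN w))/contrapT Sw] := pselect (N w).
    by left.
  right; rewrite -bigcup_seq; apply: contrapT => nS.
  have Sy k : S k w < y k.
    rewrite ltNge; apply/negP => yS; apply: nS.
    by exists k => //=; rewrite mem_index_enum.
  have : \sum_(k < K n) S k w < x * l * q.
    rewrite -sumy; apply: ltr_sum => //; apply/hasP.
    by exists (Ordinal (K_gt0 n)) => //; rewrite mem_index_enum.
  apply/negP; rewrite -leNgt; move: Aw; rewrite /A/= Sw.
  have -> : Num.sqrt (l / absE n) = q^-1.
    have -> : l / absE n = q^-1 ^+ 2 by rewrite EE; field; rewrite !gt_eqF.
    by rewrite sqrtr_sqr ger0_norm// invr_ge0 ltW.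
  rewrite ler_pdivlMl// EE; congr (_ <= _); field.
  by rewrite gt_eqF.
apply: le_trans (le_measure P _ _ subA) _; rewrite ?inE//.
  by apply: measurableU => //; exact: bigsetU_measurable.
apply: le_trans (measureU2 _ _ _) _ => //; first exact: bigsetU_measurable.
rewrite /= PN add0e; apply: le_trans (probability_bigsetU_le P _ mtail) _.
apply: le_trans (lee_sum _ (fun k _ => tail k)) _.
rewrite sumEFin lee_fin sumr_const card_ord -[leLHS]mulr_natl.
rewrite [leLHS]mulrDr lerD2l.
by rewrite mulrA mulrC mulrA.
Qed.
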